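(* Let $\mathcal{G}=(W,\leq,R_{N_1},R_{N_2})$ be an $\hat N$-frame. Define $Y_0:=\{z\in W: \text{there is no } x\in W\text{ with } zR_{N_2}x\}$. Then: 1. For all $x,y\in W$: (a) $xR_{N_2}y$ iff $\exists z\in W(x\leq z\ \&\ y\leq z\ \&\ z\notin Y_0)$; (b) $xR_{N_1}y$ iff $\exists z\in W(x\leq z\ \&\ y\leq z)$. 2. $\Psi(\mathcal{G}):=(W,\leq,Y_0)$ is a sub-normal frame. If $\mathcal{G}$ is an $\hat N'$-frame, then $\Psi(\mathcal{G})$ is a sub-normal identity frame. 3. If $v$ is a valuation on $\mathcal{G}$, then $v$ is a valuation on $\Psi(\mathcal{G})$ such that for all $\alpha\in F$ and $x\in W$: (a) $(\mathcal{G},v),x\vDash\alpha\Leftrightarrow(\Psi(\mathcal{G}),v),x\vDash\alpha$; (b) $(\mathcal{G},v)\vDash\alpha\Leftrightarrow(\Psi(\mathcal{G}),v)\vDash\alpha$; (c) $\mathcal{G}\vDash\alpha\Leftrightarrow\Psi(\mathcal{G})\vDash\alpha$.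
   Context: $F$ is the set of formulas built from propositional variables and constants $\top,\bot$ with $\wedge,\vee,\rightarrow,\neg,\sim$. A sub-normal frame is $(W,\leq,Y_0)$ with $(W,\leq)$ a nonempty poset and $Y_0\subseteq W$ an upset such that for all $x\in W$: if for every $y\geq x$ there is $z\geq y$ with $z\in Y_0$, then $x\in Y_0$. It is a sub-normal identity frame if moreover for all $x,y\in W\setminus Y_0$, $x\leq y$ implies $y\leq x$. A strictly condensed $J$-frame is a triple $(X,\leq,R_N)$ with $(X,\leq)$ a nonempty poset and $R_N$ a binary relation on $X$ such that: (i) $x\leq x'$, $x'R_Ny'$, $y\leq y'$ imply $xR_Ny$; (ii) $R_N$ is symmetric; (iii) $\forall x,y\,(xR_Ny\Rightarrow\exists z(x\leq z\ \&\ y\leq z\ \&\ xR_Nz))$. It is a strictly condensed $H$-frame if moreover $R_N$ is reflexive. An $\hat N$-frame is $(X,\leq,R_{N_1},R_{N_2})$ such that (1) $(X,\leq,R_{N_1})$ is a strictly condensed $H$-frame; (2) $(X,\leq,R_{N_2})$ is a strictly condensed $J$-frame; (3) for all $x\in X$: if for every $y$ with $xR_{N_1}y$ there is $z$ with $yR_{N_1}z$ and no $z'$ with $zR_{N_2}z'$, then there is no $z''$ with $xR_{N_2}z''$. An $\hat N'$-frame is an $\hat N$-frame such that $xR_{N_2}y$ implies $y\leq x$. On either kind of frame, a valuation assigns an upset to each propositional variable. Truth: variables via $v$; $\top$ everywhere, $\bot$ nowhere; $\wedge,\vee$ pointwise; $x\vDash\alpha\rightarrow\beta$ iff for all $y\geq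 x$, $y\vDash\alpha$ implies $y\vDash\beta$. On sub-normal frames: $x\vDash\neg\alpha$ iff for all $y\geq x$, $y\nvDash\alpha$; $x\vDash\sim\alpha$ iff for all $y\geq x$, $y\vDash\alpha$ implies $y\in Y_0$. On $\hat N$-frames: $x\vDash\neg\alpha$ iff for all $y$, $xR_{N_1}y$ implies $y\nvDash\alpha$; $x\vDash\sim\alpha$ iff for all $y$, $xR_{N_2}y$ implies $y\nvDash\alpha$. $(\mathcal{G},v)\vDash\alpha$ means truth at all points; $\mathcal{G}\vDash\alpha$ means truth at all points under all valuations. *)

(* Defs.v *)
From Stdlib Require Import Relations.

Set Implicit Arguments.
Unset Strict Implicit.

Inductive formula (Atom : Type) : Type :=
| Var (p : Atom)
| Top
| Bot
| And (a b : formula Atom)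
| Or (a b : formula Atom)
| Imp (a b : formula Atom)
| Neg (a : formula Atom)
| Sim (a : formula Atom).

Arguments Top {Atom}.
Arguments Bot {Atom}.

Definition upset (W : Type) (le : relation W) (A : W -> Prop) : Prop :=
  forall x y, A x -> le x y -> A y.

(* Upsets are not bundled with their closure proof, so that one and the same
   [v] can be a valuation on different frames over the same carrier. *)
Definition is_valuation (Atom W : Type) (le : relation W)
    (v : Atom -> W -> Prop) : Prop :=
  forall p, upset le (v p).

(* The structures below carry data only; the frame conditions are separate
   predicates. *)
Record sn_structure : Type := SnStructure {
  sn_carrier :> Type;
  sn_le : relation sn_carrier;
  sn_Y0 : sn_carrier -> Prop
}.

Record is_subnormal_frame (S : sn_structure) : Prop := {
  sn_nonempty : inhabited S;
  sn_order : order S (@sn_le S);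
  sn_Y0_upset : upset (@sn_le S) (@sn_Y0 S);
  sn_Y0_dense : forall x : S,
    (forall y, sn_le x y -> exists z, sn_le y z /\ sn_Y0 z) -> sn_Y0 x
}.

Record is_subnormal_identity_frame (S : sn_structure) : Prop := {
  sni_subnormal : is_subnormal_frame S;
  sni_identity : forall x y : S,
    ~ sn_Y0 x -> ~ sn_Y0 y -> sn_le x y -> sn_le y x
}.

Record is_sc_J_frame (X : Type) (le R : relation X) : Prop := {
  scJ_nonempty : inhabited X;
  scJ_order : order X le;
  scJ_down : forall x x' y y', le x x' -> R x' y' -> le y y' -> R x y;
  scJ_sym : symmetric X R;
  scJ_condensed : forall x y, R x y -> exists z, le x z /\ le y z /\ R x z
}.

Record is_sc_H_frame (X : Type) (le R : relation X) : Prop := {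
  scH_J : is_sc_J_frame le R;
  scH_refl : reflexive X R
}.

Record N_structure : Type := NStructure {
  N_carrier :> Type;
  N_le : relation N_carrier;
  N_R1 : relation N_carrier;
  N_R2 : relation N_carrier
}.

Record is_Nhat_frame (G : N_structure) : Prop := {
  Nhat_H : is_sc_H_frame (@N_le G) (@N_R1 G);
  Nhat_J : is_sc_J_frame (@N_le G) (@N_R2 G);
  Nhat_dense : forall x : G,
    (forall y, N_R1 x y ->
       exists z, N_R1 y z /\ ~ (exists z', N_R2 z z')) ->
    ~ (exists z'', N_R2 x z'')
}.

Record is_Nhat'_frame (G : N_structure) : Prop := {
  Nhat'_Nhat : is_Nhat_frame G;
  Nhat'_R2_le : forall x y : G, N_R2 x y -> N_le y x
}.

Fixpoint sn_forces (Atom : Type) (S : sn_structure) (v : Atom -> S -> Prop)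
    (x : S) (a : formula Atom) {struct a} : Prop :=
  match a with
  | Var p => v p x
  | Top => True
  | Bot => False
  | And b c => sn_forces v x b /\ sn_forces v x c
  | Or b c => sn_forces v x b \/ sn_forces v x c
  | Imp b c => forall y, sn_le x y -> sn_forces v y b -> sn_forces v y c
  | Neg b => forall y, sn_le x y -> ~ sn_forces v y b
  | Sim b => forall y, sn_le x y -> sn_forces v y b -> sn_Y0 y
  end.

Fixpoint N_forces (Atom : Type) (G : N_structure) (v : Atom -> G -> Prop)
    (x : G) (a : formula Atom) {struct a} : Prop :=
  match a with
  | Var p => v p x
  | Top => True
  | Bot => False
  | And b c => N_forces v x b /\ N_forces v x c
  | Or b c => N_forces v x b \/ N_forces v x c
  | Imp b c => forall y, N_le x y -> N_forces v y b -> N_forces v y c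
  | Neg b => forall y, N_R1 x y -> ~ N_forces v y b
  | Sim b => forall y, N_R2 x y -> ~ N_forces v y b
  end.

Definition sn_model_true (Atom : Type) (S : sn_structure)
    (v : Atom -> S -> Prop) (a : formula Atom) : Prop :=
  forall x, sn_forces v x a.

Definition N_model_true (Atom : Type) (G : N_structure)
    (v : Atom -> G -> Prop) (a : formula Atom) : Prop :=
  forall x, N_forces v x a.

Definition sn_valid (Atom : Type) (S : sn_structure) (a : formula Atom) : Prop :=
  forall v : Atom -> S -> Prop, is_valuation (@sn_le S) v -> sn_model_true v a.

Definition N_valid (Atom : Type) (G : N_structure) (a : formula Atom) : Prop :=
  forall v : Atom -> G -> Prop, is_valuation (@N_le G) v -> N_model_true v a.

Definition Y0_of (G : N_structure) (z : G) : Prop := ~ (exists x, N_R2 z x).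

Definition Psi (G : N_structure) : sn_structure :=
  SnStructure (@N_le G) (@Y0_of G).

(* Main.v *)
(** Strict condensedness together with downward closure says that [R] is
    determined by the upset of its reflexive points: [x R y] holds exactly when
    [x] and [y] have a common upper bound [z] with [z R z], and [z R z] holds as
    soon as [z] has some [R]-successor. For [N_R1] every point is reflexive; for
    [N_R2] the reflexive points are the complement of [Y0]. Since truth persists
    upwards, quantifying over [R]-successors can be replaced by quantifying over
    these common upper bounds. *)

Require Import Defs.
From Stdlib Require Import Relations Classical.

Set Implicit Arguments.
Unset Strict Implicit.

Section StrictlyCondensedFrames.

Variables (X : Type) (le R : relation X).
Hypothesis frame_R : is_sc_J_frame le R.

(** Condensedness puts a successor of [z] above [z] itself; downward closure then lowers that
    successor to [z]. *)
Lemma sc_J_serial_refl (z w : X) : R z w -> R z z.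
Proof.
  intros Rzw.
  destruct (scJ_condensed frame_R Rzw) as (u & le_zu & _ & Rzu).
  exact (scJ_down frame_R (ord_refl _ _ (scJ_order frame_R) z) Rzu le_zu).
Qed.

Lemma sc_J_iff_common_bound (x y : X) :
  R x y <-> exists z, le x z /\ le y z /\ exists w, R z w.
Proof.
  split.
  - intros Rxy.
    destruct (scJ_condensed frame_R Rxy) as (z & le_xz & le_yz & Rxz).
    exists z; repeat split; trivial.
    (* By symmetry, [x] serves as the successor of the bound [z]. *)
    exists x; exact (scJ_sym frame_R Rxz).
  - intros (z & le_xz & le_yz & w & Rzw).
    exact (scJ_down frame_R le_xz (sc_J_serial_refl Rzw) le_yz).
Qed.

Lemma sc_J_no_successor_upset : upset le (fun z => ~ exists w, R z w).
Proof.
  intros x y dead_x le_xy (w & Ryw); apply dead_x; exists w.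
  exact (scJ_down frame_R le_xy Ryw (ord_refl _ _ (scJ_order frame_R) w)).
Qed.

End StrictlyCondensedFrames.

(** Persistence is proved on the [sn_structure] side, where [Imp], [Neg] and [Sim] all quantify over
    the points above, so transitivity settles them at once. *)
Lemma sn_forces_persistent (Atom : Type) (S : sn_structure)
    (v : Atom -> S -> Prop) (trans : transitive S (@sn_le S))
    (hv : is_valuation (@sn_le S) v) (a : formula Atom) :
  upset (@sn_le S) (fun x => sn_forces v x a).
Proof.
  induction a as [p | | | b IHb c IHc | b IHb c IHc | b _ c _ | b _ | b _];
    intros x y; cbn; intros fx le_xy.
  - exact (hv p x y fx le_xy).
  - exact I.
  - exact fx.
  - destruct fx as [fb fc]; split; [exact (IHb x y fb le_xy) | exact (IHc x y fc le_xy)].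
  - destruct fx as [fb | fc];
      [left; exact (IHb x y fb le_xy) | right; exact (IHc x y fc le_xy)].
  - intros z le_yz; exact (fx z (trans x y z le_xy le_yz)).
  - intros z le_yz; exact (fx z (trans x y z le_xy le_yz)).
  - intros z le_yz; exact (fx z (trans x y z le_xy le_yz)).
Qed.

Section NhatFrames.

Variable G : N_structure.
Hypothesis frame_G : is_Nhat_frame G.

Lemma N_le_order : order G (@N_le G).
Proof. exact (scJ_order (Nhat_J frame_G)). Qed.

Lemma N_le_refl (x : G) : N_le x x.
Proof. exact (ord_refl _ _ N_le_order x). Qed.

Lemma N_R1_iff (x y : G) : N_R1 x y <-> exists z : G, N_le x z /\ N_le y z.
Proof.
  destruct (Nhat_H frame_G) as [frame_R1 R1_refl].
  rewrite (sc_J_iff_common_bound frame_R1).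
  split; intros (z & bounds).
  - exists z; tauto.
  - exists z; repeat split; try tauto. exists z; apply R1_refl.
Qed.

Lemma N_R2_iff (x y : G) :
  N_R2 x y <-> exists z : G, N_le x z /\ N_le y z /\ ~ Y0_of z.
Proof.
  rewrite (sc_J_iff_common_bound (Nhat_J frame_G)).
  split; intros (z & le_xz & le_yz & alive_z); exists z;
    repeat split; trivial.
  - intros dead_z; exact (dead_z alive_z).
  (* [~ Y0_of z] is the double negation of having a successor, so recovering the successor is
     classical. *)
  - exact (NNPP _ alive_z).
Qed.

Lemma Psi_subnormal : is_subnormal_frame (Psi G).
Proof.
  split; cbn.
  - exact (scJ_nonempty (Nhat_J frame_G)).
  - exact N_le_order.
  - exact (sc_J_no_successor_upset (Nhat_J frame_G)).
  (* An [N_R1]-successor [y] of [x] shares an upper bound [w] with [x]. Density at [w] yields a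
     point of [Y0] above [w], hence above [y], and so [N_R1]-related to [y]. *)
  - intros x dense_x; apply (Nhat_dense frame_G); intros y R1xy.
    apply N_R1_iff in R1xy; destruct R1xy as (w & le_xw & le_yw).
    destruct (dense_x w le_xw) as (z & le_wz & Y0z).
    exists z; split; [| exact Y0z].
    apply N_R1_iff; exists z; split; [| apply N_le_refl].
    exact (ord_trans _ _ N_le_order y w z le_yw le_wz).
Qed.

Lemma Psi_subnormal_identity :
  is_Nhat'_frame G -> is_subnormal_identity_frame (Psi G).
Proof.
  intros frame_G'; split; [exact Psi_subnormal |].
  cbn; intros x y _ alive_y le_xy.
  (* The point [y] is itself a common bound of [x] and [y] outside [Y0], which gives [N_R2 x y]. *)
  apply (Nhat'_R2_le frame_G'), N_R2_iff.
  exists y; repeat split; [exact le_xy | apply N_le_refl | exact alive_y].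
Qed.

Lemma N_forces_iff_sn_forces (Atom : Type) (v : Atom -> G -> Prop)
    (hv : is_valuation (@N_le G) v) (a : formula Atom) (x : G) :
  N_forces v x a <-> @sn_forces Atom (Psi G) v x a.
Proof.
  pose proof (@sn_forces_persistent Atom (Psi G) v (ord_trans _ _ N_le_order) hv)
    as persistent.
  revert x;
    induction a as [p | | | b IHb c IHc | b IHb c IHc | b IHb c IHc | b IHb | b IHb];
    intros x; cbn; try tauto.
  - rewrite IHb, IHc; tauto.
  - rewrite IHb, IHc; tauto.
  - split; intros f y le_xy fb; apply IHc, (f y le_xy), IHb, fb.
  - split; intros f y rel_xy fb.
    + apply (f y); [| apply IHb, fb].
      apply N_R1_iff; exists y; split; [exact rel_xy | apply N_le_refl].
    + apply N_R1_iff in rel_xy; destruct rel_xy as (z & le_xz & le_yz).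
      (* The induction hypothesis carries the truth of [b] at [y] over to [Psi G], and persistence
         lifts it to the common bound [z], which lies above [x]. *)
      exact (f z le_xz (persistent b y z (proj1 (IHb y) fb) le_yz)).
  - split; intros f y rel_xy fb.
    (* The goal [Y0_of y] is a negation: a successor of [y] would make [y] a common bound outside
       [Y0], so that [N_R2 x y]. *)
    + intros alive_y; apply (f y); [| apply IHb, fb].
      apply N_R2_iff; exists y; repeat split;
        [exact rel_xy | apply N_le_refl | intros dead_y; exact (dead_y alive_y)].
    + apply N_R2_iff in rel_xy; destruct rel_xy as (z & le_xz & le_yz & alive_z).
      exact (alive_z (f z le_xz (persistent b y z (proj1 (IHb y) fb) le_yz))).
Qed.

Lemma N_model_true_iff_sn_model_true (Atom : Type) (v : Atom -> G -> Prop)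
    (hv : is_valuation (@N_le G) v) (a : formula Atom) :
  N_model_true v a <-> @sn_model_true Atom (Psi G) v a.
Proof.
  split; intros f x; apply (N_forces_iff_sn_forces hv), f.
Qed.

Lemma N_valid_iff_sn_valid (Atom : Type) (a : formula Atom) :
  N_valid G a <-> sn_valid (Psi G) a.
Proof.
  split; intros f v hv; apply (N_model_true_iff_sn_model_true hv), (f v hv).
Qed.

End NhatFrames.

Theorem theorem5p5 (Atom : Type) (G : N_structure) (hG : is_Nhat_frame G) :
  (forall x y : G,
     (N_R2 x y <-> exists z : G, N_le x z /\ N_le y z /\ ~ Y0_of z) /\
     (N_R1 x y <-> exists z : G, N_le x z /\ N_le y z)) /\
  (is_subnormal_frame (Psi G) /\
   (is_Nhat'_frame G -> is_subnormal_identity_frame (Psi G))) /\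
  (forall v : Atom -> G -> Prop, is_valuation (@N_le G) v ->
     is_valuation (@sn_le (Psi G)) v /\
     (forall (a : formula Atom) (x : G),
        N_forces v x a <-> @sn_forces Atom (Psi G) v x a) /\
     (forall a : formula Atom,
        N_model_true v a <-> @sn_model_true Atom (Psi G) v a) /\
     (forall a : formula Atom, N_valid G a <-> sn_valid (Psi G) a)).
Proof.
  split; [| split].
  - intros x y; split; [exact (N_R2_iff hG x y) | exact (N_R1_iff hG x y)].
  - split; [exact (Psi_subnormal hG) | exact (Psi_subnormal_identity hG)].
  - intros v hv; split; [exact hv | split; [| split]].
    + exact (N_forces_iff_sn_forces hG hv).
    + exact (N_model_true_iff_sn_model_true hG hv).
    + exact (N_valid_iff_sn_valid hG (Atom := Atom)).
Qed.
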